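(* Let $d,n\ge1$, let $\mathbf v^1,\dots,\mathbf v^n\in\mathbb R^d$ satisfy $\sum_{i=1}^n\mathbf v^i=\mathbf 0$, and let $\mu_{ij}=\mu_{ji}\ge0$ ($i\ne j$) be such that the associated symmetric transition matrix $\mathbb B$ satisfies $I_1(\mathbb B)\neq0$. For a tree $T$ in the graph $\Gamma$ associated to the system $$\frac{\partial f_i}{\partial t}+\mathbf v^i\cdot\nabla_{\mathbf x}f_i+\sum_{j\ne i}\bigl(\mu_{ij}f_i-\mu_{ji}f_j\bigr)=0,\qquad i=1,\dots,n,$$ denote by $\mathbf w(T)$ the sum of the velocities $\mathbf v^i$ over the vertices $i$ of $T$. Then the diffusion matrix $\mathbb D$ of the system is $$\mathbb D=\frac2{I_1(\mathbb B)}\sum_{F=\{T^1,T^2\}\in\mathcal F_2}\mu_{T^1}\,\mu_{T^2}\,\bigl(\mathbf w(T^1)\otimes\mathbf w(T^1)\bigr).$$ In particular, the matrix $\mathbb D$ is non-negative definite.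
   Context: The transition matrix $\mathbb B$ is the symmetric $n\times n$ matrix with $\mathbb B_{ij}=-\mu_{ij}$ ($i\ne j$) and $\mathbb B_{ii}=\sum_{j\ne i}\mu_{ij}$. $\mathbb B(i_1,\dots,i_r)$ is the submatrix of $\mathbb B$ obtained by deleting the rows and columns with indices $i_1,\dots,i_r$ (the determinant of the empty matrix is $1$), and $I_1(\mathbb B):=\sum_{i=1}^n\det\mathbb B(i)$; $I_1(\mathbb B)\ne0$ holds when $\mathbb B$ is irreducible. Diffusion matrix: set $p(\lambda,\mathbf k):=\det(\lambda\mathbb I+\mathrm{diag}(\mathbf v^i\cdot\mathbf k)+\mathbb B)$ and let $\lambda(\mathbf k)$ be the unique smooth branch of solutions of $p(\lambda(\mathbf k),\mathbf k)=0$ near $\mathbf k=\mathbf 0$ with $\lambda(\mathbf 0)=0$. The drift velocity is $\mathbf v_{\mathrm{drift}}=-\nabla_{\mathbf k}\lambda(\mathbf 0)$, which for symmetric $\mathbb B$ vanishes if and only if $\sum_i\mathbf v^i=\mathbf 0$. When $\mathbf v_{\mathrm{drift}}=\mathbf 0$, the diffusion matrix is the $d\times d$ matrix $$\mathbb D:=D^2\lambda(\mathbf 0)=-\frac2{I_1(\mathbb B)}\sum_{1\le h<m\le n}\det\mathbb B(h,m)\,(\mathbf v^h\otimes\mathbf v^m)^*,$$ where $(\mathbf a\otimes\mathbf b)_{j\ell}=a_jb_\ell$ and $M^*=\tfrac12(M+M^{T})$ denotes the symmetric part. Graph: $\Gamma$ is the undirected weighted graph with vertices $1,\dots,n$ (vertex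 $i$ representing $\mathbf v^i$) and with an arc of weight $\mu_{ij}$ between $i\ne j$ whenever $\mu_{ij}>0$. A tree is a connected graph without simple cycles (a single vertex is a tree). $\mathcal F_2$ is the set of forests in $\Gamma$ that contain all vertices of $\Gamma$ and consist of exactly two (disjoint) trees $T^1,T^2$, where $T^1$ is the tree containing the smallest vertex. $\mu_T$ is the product of the weights of all arcs of $T$, equal to $1$ if $T$ is a single vertex. *)

(* Defs.v *)
From HB Require Import structures.
From mathcomp Require Import all_boot all_order all_algebra.
From mathcomp Require Import all_classical all_reals all_analysis.

Set Implicit Arguments.
Unset Strict Implicit.
Unset Printing Implicit Defensive.

Import Order.TTheory GRing.Theory Num.Theory.
Import numFieldNormedType.Exports.

Local Open Scope ring_scope.

(* The diagonal values mu i i are junk: nothing below depends on them. *)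
Definition transition_mx (R : realType) (n : nat) (mu : 'I_n -> 'I_n -> R)
    : 'M[R]_n :=
  \matrix_(i, j) (if i == j then \sum_(l | l != i) mu i l else - mu i j).

(* B(i_1, ..., i_r) is del_mx [set i_1; ...; i_r] B: [enum_val] lists the
   remaining indices in increasing order. *)
Definition del_mx (R : realType) (n : nat) (S : {set 'I_n}) (B : 'M[R]_n)
    : 'M[R]_#|~: S| :=
  mxsub (fun a => enum_val a) (fun a => enum_val a) B.

Definition I1 (R : realType) (n : nat) (B : 'M[R]_n) : R :=
  \sum_(i < n) \det (del_mx [set i]%SET B).

Definition dotp (R : realType) (d : nat) (a b : 'rV[R]_d) : R :=
  \sum_(j < d) a 0 j * b 0 j.

Definition tensor (R : realType) (d : nat) (a b : 'rV[R]_d) : 'M[R]_d :=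
  \matrix_(j, l) (a 0 j * b 0 l).

Definition sym_part (R : realType) (d : nat) (M : 'M[R]_d) : 'M[R]_d :=
  2^-1 *: (M + M^T).

Definition nonneg_definite (R : realType) (d : nat) (M : 'M[R]_d) : Prop :=
  M^T = M /\ forall x : 'rV[R]_d, 0 <= \sum_(j < d) \sum_(l < d) x 0 j * M j l * x 0 l.

Definition char_fun (R : realType) (n d : nat) (v : 'I_n -> 'rV[R]_d)
    (mu : 'I_n -> 'I_n -> R) (lam : R) (k : 'rV[R]_d) : R :=
  \det (lam%:M + diag_mx (\row_i dotp (v i) k) + transition_mx mu).

Definition iter_derive (R : realType) (d : nat) (s : seq 'rV[R]_d)
    (f : 'rV[R]_d -> R) : 'rV[R]_d -> R :=
  foldr (fun (u : 'rV[R]_d) (g : 'rV[R]_d -> R) (k : 'rV[R]_d) => 'D_u g k) f s.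

(* C^infinity on some neighbourhood of 0, common to all orders. *)
Definition smooth_near0 (R : realType) (d : nat) (f : 'rV[R]_d -> R) : Prop :=
  \forall k \near (0 : 'rV[R]_d),
    forall s : seq 'rV[R]_d, differentiable (iter_derive s f) k.

Definition smooth_branch (R : realType) (n d : nat) (v : 'I_n -> 'rV[R]_d)
    (mu : 'I_n -> 'I_n -> R) (lam : 'rV[R]_d -> R) : Prop :=
  [/\ lam 0 = 0,
      smooth_near0 lam
    & \forall k \near (0 : 'rV[R]_d), char_fun v mu (lam k) k = 0].

Definition hessian (R : realType) (d : nat) (f : 'rV[R]_d -> R)
    (k : 'rV[R]_d) : 'M[R]_d :=
  \matrix_(j, l) 'D_(delta_mx 0 j) (fun k' => 'D_(delta_mx 0 l) f k') k.

(* Closed form of the Hessian at 0 of the smooth branch when the drift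
   velocity vanishes. *)
Definition diffusion_mx (R : realType) (n d : nat) (v : 'I_n -> 'rV[R]_d)
    (mu : 'I_n -> 'I_n -> R) : 'M[R]_d :=
  - (2 / I1 (transition_mx mu)) *:
    \sum_(h < n) \sum_(m < n | (h < m)%N)
      \det (del_mx [set h; m]%SET (transition_mx mu))
        *: sym_part (tensor (v h) (v m)).

(* An undirected arc {i, j} is stored once, as the pair (i, j) with i < j. *)
Definition arcs (R : realType) (n : nat) (mu : 'I_n -> 'I_n -> R)
    : {set 'I_n * 'I_n} :=
  [set a : 'I_n * 'I_n | (a.1 < a.2)%N && (0 < mu a.1 a.2)]%SET.

(* Vertex set and arc set. *)
Definition graph (n : nat) :=
  ({set 'I_n} * {set 'I_n * 'I_n})%type.

Definition adj (n : nat) (T : graph n) : rel 'I_n :=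
  fun x y => ((x, y) \in T.2) || ((y, x) \in T.2).

Definition subgraph_of (R : realType) (n : nat) (mu : 'I_n -> 'I_n -> R)
    (T : graph n) : Prop :=
  T.2 \subset arcs mu /\
  forall a, a \in T.2 -> a.1 \in T.1 /\ a.2 \in T.1.

(* The vertex sequence of a simple cycle in a loopless simple graph has
   length at least 3. *)
Definition is_tree (n : nat) (T : graph n) : Prop :=
  [/\ T.1 != finset.set0,
      forall x y, x \in T.1 -> y \in T.1 -> connect (adj T) x y
    & forall c : seq 'I_n, (2 < size c)%N -> ~~ ucycleb (adj T) c].

(* A forest {T1, T2} is stored as the ordered pair (T1, T2) in which T1
   contains the smallest vertex, so each one occurs exactly once. *)
Definition is_forest2 (R : realType) (n : nat) (mu : 'I_n -> 'I_n -> R)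
    (F : graph n * graph n) : Prop :=
  [/\ subgraph_of mu F.1 /\ is_tree F.1,
      subgraph_of mu F.2 /\ is_tree F.2,
      [disjoint F.1.1 & F.2.1],
      (F.1.1 :|: F.2.1)%SET = [set: 'I_n]%SET
    & exists2 i : 'I_n, i \in F.1.1 & i = 0%N :> nat].

Definition forests2 (R : realType) (n : nat) (mu : 'I_n -> 'I_n -> R)
    : {set graph n * graph n} :=
  [set F | `[< is_forest2 mu F >]]%SET.

Definition tree_weight (R : realType) (n : nat) (mu : 'I_n -> 'I_n -> R)
    (T : graph n) : R :=
  \prod_(a in T.2) mu a.1 a.2.

Definition tree_velocity (R : realType) (n d : nat) (v : 'I_n -> 'rV[R]_d)
    (T : graph n) : 'rV[R]_d :=
  \sum_(i in T.1) v i.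

(* Main.v *)
(* Expanding the rows of a principal minor of B by multilinearity writes
   det B(S) as the sum over all functions f from the complement of S to the
   vertices of prod mu_{i, f i} det(I - P_f); the last determinant is 1 when
   every vertex reaches S under f and 0 otherwise, and such f are the spanning
   forests rooted at S.  Hence det B(h,m) is the weighted number of two-tree
   forests separating h and m; inserting this in the closed form of the
   diffusion matrix and summing over h in T^1, m in T^2 gives
   w(T^1) (x) w(T^2) = - w(T^1) (x) w(T^1).

   For the Hessian, p(lambda, k) = sum_S det B(S) prod_{i in S} g_i(k) with
   g_i = lambda + v^i . k vanishing at 0, so only |S| <= 2 contributes to the
   derivatives of order at most two.  Since det B = 0 and det B(i) does not
   depend on i, the gradient of lambda vanishes at 0 and the second order terms
   give the formula. *)

From HB Require Import structures.
Require Import Defs.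
From mathcomp Require Import all_boot all_order all_algebra.
From mathcomp Require Import all_classical all_reals all_analysis.
From mathcomp Require Import perm ring.
Import Order.TTheory GRing.Theory Num.Theory.
Import numFieldNormedType.Exports.
Local Open Scope ring_scope.

Set Implicit Arguments.
Unset Strict Implicit.
Unset Printing Implicit Defensive.

(** * Principal minors and rooted functions *)

Lemma det_mxsub_bij (R : comNzRingType) (m n : nat) (f : 'I_m -> 'I_n)
    (A : 'M[R]_n) :
  bijective f -> \det (mxsub f f A) = \det A.
Proof.
move=> fbij; have := bij_eq_card fbij; rewrite !card_ord => mn.
move: f fbij; rewrite mn => f fbij.
have finj := bij_inj fbij.
have -> : mxsub f f A = row_perm (perm finj) (col_perm (perm finj) A).
  by apply/matrixP => i j; rewrite !mxE !permE.
rewrite row_permE col_permE !det_mulmx !det_perm odd_permV mulrCA.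
by rewrite -signr_addb addbb mulr1.
Qed.

Section Minors.
Variables (R : realType) (n : nat).
Implicit Types (S : {set 'I_n}) (B : 'M[R]_n).

(** With the indices of [S] listed first, the matrix on the right is block lower triangular with an
    identity block. It has size [n] for every [S]. *)
Lemma det_del_mx S B :
  \det (del_mx S B) =
  \det (\matrix_(i, j) (if i \in S then (i == j)%:R else B i j)).
Proof.
pose f (k : 'I_(#|S| + #|(~: S)%SET|)) : 'I_n :=
  match fintype.split k with inl a => enum_val a | inr b => enum_val b end.
have finj : injective f.
  move=> k l; rewrite /f -{2}(splitK k) -{2}(splitK l).
  case: (fintype.split k) (fintype.split l) => [a|a] [b|b] //=.
  - by move=> /enum_val_inj->.
  - by move=> ab; have := enum_valP b; rewrite inE -ab (enum_valP a).
  - by move=> ab; have := enum_valP a; rewrite inE ab (enum_valP b).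
  - by move=> /enum_val_inj->.
have fbij : bijective f by apply: inj_card_bij => //; rewrite !card_ord cardsC card_ord.
rewrite -(det_mxsub_bij _ fbij).
have -> : mxsub f f (\matrix_(i, j) (if i \in S then (i == j)%:R else B i j)) =
    block_mx 1%:M 0 (\matrix_(i, j) B (enum_val i) (enum_val j)) (del_mx S B).
  apply/matrixP => k l; rewrite -(splitK k) -(splitK l) 2![LHS]mxE /f !unsplitK.
  case: (fintype.split k) => a; case: (fintype.split l) => b /=.
  - by rewrite block_mxEul !mxE enum_valP (inj_eq enum_val_inj).
  - rewrite block_mxEur !mxE enum_valP; case: eqP => // ab.
    by have := enum_valP b; rewrite inE -ab (enum_valP a).
  - by rewrite block_mxEdl !mxE; have := enum_valP a; rewrite inE => /negPf->.
  - by rewrite block_mxEdr !mxE; have := enum_valP a; rewrite inE => /negPf->.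
by rewrite det_lblock det1 mul1r.
Qed.

(** In the Leibniz formula every factor splits in two; [S] collects the rows where the diagonal
    entry is chosen. *)
Lemma det_diag_add (x : 'rV[R]_n) B :
  \det (diag_mx x + B) =
  \sum_(S : {set 'I_n}) (\prod_(i in S) x 0 i) * \det (del_mx S B).
Proof.
under eq_bigr do rewrite det_del_mx.
rewrite /determinant; under [RHS]eq_bigr do rewrite big_distrr /=.
rewrite exchange_big /=; apply: eq_bigr => s _.
under eq_bigr do rewrite !mxE.
rewrite bigA_distr big_distrr /=; apply: eq_bigr => S _.
rewrite mulrCA; congr (_ * _).
rewrite [X in _ = X * _]big_mkcond -big_split /=; apply: eq_bigr => i _.
by rewrite !mxE; case: ifP; rewrite ?mul1r ?mulr_natr.
Qed.

End Minors.

Section RootedFunctions.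
Variables (R : realType) (n : nat).
Implicit Types (S : {set 'I_n}) (f : {ffun 'I_n -> 'I_n}).

(* [f] encodes a spanning forest with root set [S]: arcs go from [i] to its
   parent [f i], and every vertex ends up at a root. *)
Definition rooted S f :=
  [forall i in S, f i == i] && [forall i, [exists s in S, fconnect f i s]].

(** The rank [r] is the number of steps to [S]; its decrease along [f] is the induction measure used
    below. *)
Lemma rootedP S f :
  reflect ((forall i, i \in S -> f i = i) /\
           exists r : 'I_n -> nat, forall i, i \notin S -> (r (f i) < r i)%N)
          (rooted S f).
Proof.
apply: (iffP andP) => [[/forall_inP fS /forallP reach]|[fS [r r_lt]]].
  split=> [i /fS/eqP//|].
  have ex i : exists k, iter k f i \in S.
    have /existsP[s /andP[sS /iter_findex cis]] := reach i.
    by exists (findex f i s); rewrite cis.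
  exists (fun i => ex_minn (ex i)) => i iS.
  case: ex_minnP => k _ kmin; case: ex_minnP => -[|m mS _]; first by rewrite (negPf iS).
  by apply: kmin; rewrite -iterSr.
split; first by apply/forall_inP => i /fS->.
apply/forallP => i; elim: {i}(r i).+1 {-2}i (ltnSn (r i)) => // k IH i ik.
case: (boolP (i \in S)) => [iS|iS]; first by apply/existsP; exists i; rewrite iS connect0.
have /existsP[s /andP[sS cis]] : [exists s in S, fconnect f (f i) s].
  by apply: IH; apply: leq_trans (r_lt i iS) _; rewrite -ltnS.
by apply/existsP; exists s; rewrite sS (connect_trans (fconnect1 f i)).
Qed.

Lemma rooted_neq S f i : rooted S f -> i \notin S -> f i != i.
Proof.
case/rootedP=> _ [r r_lt] iS; apply/eqP => fi.
by have := r_lt i iS; rewrite fi ltnn.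
Qed.

Lemma fconnect_fix f s i : f s = s -> fconnect f (f i) s = fconnect f i s.
Proof.
move=> fs; apply/idP/idP => [|/iter_findex]; first exact: connect_trans (fconnect1 f i).
case: findex => [/= ->|k]; first by rewrite fs connect0.
by rewrite iterSr => <-; apply: fconnect_iter.
Qed.

Definition fun_laplacian S f : 'M[R]_n :=
  \matrix_(i, j) ((i == j)%:R - (i \notin S)%:R * (f i == j)%:R).

(** If a rank decreases along [f], only the identity permutation contributes, with diagonal 1 since
    [f] has no fixed point outside [S]; otherwise the matrix is singular. *)
Lemma det_fun_laplacian S f : [forall i in S, f i == i] ->
  \det (fun_laplacian S f) = (rooted S f)%:R.
Proof.
move=> fS; case: (boolP (rooted S f)) => [rt|].
  have [_ [r r_lt]] := rootedP _ _ rt.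
  rewrite /determinant (bigD1 (1%g : 'S_n)) //= odd_perm1 mul1r.
  rewrite [X in X + _]big1 => [|i _]; last first.
    rewrite !mxE perm1 eqxx; case: (boolP (i \in S)) => iS; first by rewrite mul0r subr0.
    by rewrite (negPf (rooted_neq rt iS)) mulr0 subr0.
  rewrite big1 ?addr0 // => s s1.
  (* [s i = f i] at every moved [i], so a moved vertex of minimal rank would have
     a moved parent of smaller rank. *)
  suff [i /eqP si0] : exists i, fun_laplacian S f i (s i) == 0.
    by rewrite (bigD1 i) //= si0 mul0r mulr0.
  apply/existsP; apply: contraT; rewrite negb_exists => /forallP nz.
  have step i : s i != i -> i \notin S /\ s i = f i.
    move=> sii; have := nz i; rewrite !mxE [i == _]eq_sym (negPf sii) sub0r oppr_eq0.
    by rewrite mulf_eq0 !pnatr_eq0 !eqb0 negb_or !negbK => /andP[-> /eqP->].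
  have fixed i : s i = i.
    apply/eqP; elim: {i}(r i).+1 {-2}i (ltnSn (r i)) => // k IH i ik.
    apply/negPn/negP => sii; have [iS sif] := step i sii.
    have /eqP ss : s (s i) == s i.
      by apply: IH; rewrite sif; apply: leq_trans (r_lt i iS) _; rewrite -ltnS.
    by case/eqP: sii; apply: (@perm_inj _ s).
  by case/eqP: s1; apply/permP => i; rewrite fixed perm1.
rewrite /rooted fS /= negb_forall => /existsP[i0 ni0].
(* The indicator of the vertices that never reach [S] lies in the kernel. *)
pose u : 'cV[R]_n := \col_i (~~ [exists s in S, fconnect f i s])%:R.
have u0 : u != 0.
  by apply/eqP => /matrixP/(_ i0 0); rewrite !mxE ni0; apply/eqP/oner_neq0.
have Lu : fun_laplacian S f *m u = 0.
  apply/matrixP => i j; rewrite !mxE.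
  under eq_bigr do rewrite !mxE mulrBl.
  rewrite big_split /= sumrN (bigD1 i) //= eqxx mul1r big1 ?addr0; last first.
    by move=> k ki; rewrite eq_sym (negPf ki) mul0r.
  rewrite (bigD1 (f i)) //= eqxx mulr1 [X in _ - (_ + X)]big1 ?addr0; last first.
    by move=> k ki; rewrite [_ == k]eq_sym (negPf ki) mulr0 mul0r.
  case: (boolP (i \in S)) => iS.
    have -> : [exists s in S, fconnect f i s] by apply/existsP; exists i; rewrite iS connect0.
    by rewrite mul0r subr0.
  rewrite mul1r; apply/eqP; rewrite subr_eq0; apply/eqP; congr (~~ _)%:R.
  apply: eq_existsb => s; case: (boolP (s \in S)) => //= sS.
  by rewrite fconnect_fix //; apply/eqP/(forall_inP fS).
apply/eqP; apply: contraNT u0 => dL.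
have unitL : fun_laplacian S f \in unitmx by rewrite unitmxE unitfE.
by rewrite -(mulKmx unitL u) Lu mulmx0.
Qed.

(** A matrix-tree theorem for principal minors, with rooted forests encoded by parent functions. *)
Lemma det_del_transition_mx (mu : 'I_n -> 'I_n -> R) S :
  \det (del_mx S (transition_mx mu)) =
  \sum_(f | rooted S f) \prod_(i in ~: S) mu i (f i).
Proof.
rewrite det_del_mx.
(* Row [i] outside [S] is the combination over [l] of the rows [e_i - e_l] with
   coefficients [mu i l]; expand by multilinearity. *)
pose w i l := if i \in S then (l == i)%:R else mu i l.
pose e i l j : R := (i == j)%:R - (i \notin S)%:R * (l == j)%:R.
have -> : \det (\matrix_(i, j) (if i \in S then (i == j)%:R else transition_mx mu i j)) =
    \det (\matrix_(i, j) \sum_l w i l * e i l j).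
  congr (\det _); apply/matrixP => i j; rewrite !mxE /w /e.
  case: (boolP (i \in S)) => iS /=.
    by rewrite (bigD1 i) //= eqxx mul1r mul0r subr0 big1 ?addr0 // => l /negPf->; rewrite mul0r.
  case: eqVneq => [<-|ij].
    rewrite [RHS](bigD1 i) //= eqxx mul1r subrr mulr0 add0r; apply: eq_bigr => l /negPf->.
    by rewrite mulr0 subr0 mulr1.
  rewrite (bigD1 j) //= eqxx mulr1 sub0r mulrN1 big1 ?addr0 // => l /negPf->.
  by rewrite mulr0 subrr mulr0.
rewrite /determinant.
under eq_bigr => s _.
  under eq_bigr do rewrite mxE.
  rewrite bigA_distr_bigA big_distrr /=.
  under eq_bigr do rewrite big_split /= mulrCA.
  over.
rewrite exchange_big /= [RHS]big_mkcond; apply: eq_bigr => f _.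
rewrite -big_distrr /=.
have -> : \sum_(s : 'S_n) (-1) ^+ s * \prod_i e i (f i) (s i) = \det (fun_laplacian S f).
  by apply: eq_bigr => s _; congr (_ * _); apply: eq_bigr => i _; rewrite !mxE.
(* A function moving a point of [S] has a zero coefficient in [w]. *)
case: (boolP [forall i in S, f i == i]) => fS; last first.
  rewrite /rooted (negPf fS) /=; move: fS; rewrite negb_forall => /existsP[i].
  by rewrite negb_imply => /andP[iS fi]; rewrite (bigD1 i) //= /w iS (negPf fi) !mul0r.
rewrite det_fun_laplacian //; case: ifP => _; rewrite ?mulr0 // mulr1.
rewrite [RHS]big_mkcond; apply: eq_bigr => i _; rewrite /w inE.
by case: ifP => // iS /=; have /forall_inP/(_ i iS)-> := fS.
Qed.

End RootedFunctions.
(** * Rooted functions and pairs of trees *)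

Section Trees.
Variables (R : realType) (n : nat) (mu : 'I_n -> 'I_n -> R).
Hypothesis mu_sym : forall i j : 'I_n, i != j -> mu i j = mu j i.
Implicit Types (S V : {set 'I_n}) (T : graph n) (F : graph n * graph n).
Implicit Types (f : {ffun 'I_n -> 'I_n}) (r : 'I_n -> nat).

Definition arc (x y : 'I_n) : 'I_n * 'I_n := if (x < y)%N then (x, y) else (y, x).

Lemma arc_eq x y u v : arc x y = arc u v -> x = u /\ y = v \/ x = v /\ y = u.
Proof. by rewrite /arc; do 2!case: ifP => _; case=> -> ->; auto. Qed.

Lemma mu_arc x y : x != y -> mu (arc x y).1 (arc x y).2 = mu x y.
Proof. by rewrite /arc; case: ifP => //= _ /mu_sym. Qed.

Lemma arc_in_arcs x y : x != y -> (arc x y \in arcs mu) = (0 < mu x y).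
Proof.
move=> xy; rewrite inE mu_arc // /arc.
by case: (ltngtP x y) xy => [xy'|xy'|/ord_inj->]; rewrite ?eqxx //= xy'.
Qed.

Lemma adj_sym T : symmetric (adj T).
Proof. by move=> x y; rewrite /adj orbC. Qed.

Lemma adj_arc T x y : T.2 \subset arcs mu -> adj T x y = (arc x y \in T.2).
Proof.
move=> /fintype.subsetP Tsub; rewrite /adj /arc.
case: ltngtP => [xy|xy|/ord_inj->]; last by rewrite orbb.
  suff /negPf-> : (y, x) \notin T.2 by rewrite orbF.
  by apply/negP => /Tsub; rewrite inE /= ltnNge (ltnW xy).
suff /negPf-> : (x, y) \notin T.2 by [].
by apply/negP => /Tsub; rewrite inE /= ltnNge (ltnW xy).
Qed.

Lemma adj_neq T x y : T.2 \subset arcs mu -> adj T x y -> x != y.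
Proof.
move=> Tsub; rewrite (adj_arc _ _ Tsub) => /(fintype.subsetP Tsub); rewrite inE /arc.
by case: eqVneq => // ->; rewrite ltnn /= ltnn.
Qed.

(** The rank [r] certifies that following parents ends at the root [s]; positive weights place the
    parent arcs in the graph. *)
Definition parent_fun f V s r : Prop :=
  s \in V /\
  forall i, i \in (V :\ s)%SET -> [/\ f i \in V, (r (f i) < r i)%N & 0 < mu i (f i)].

Definition fun_tree f V s : graph n := (V, [set arc i (f i) | i in (V :\ s)%SET]%SET).

(** * Trees built from parent functions *)

Section FunTree.
Variables (f : {ffun 'I_n -> 'I_n}) (V : {set 'I_n}) (s : 'I_n) (r : 'I_n -> nat).
Hypothesis fP : parent_fun f V s r.

Lemma parent_neq i : i \in (V :\ s)%SET -> i != f i.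
Proof. by case: fP => _ /[apply] -[_ + _]; case: eqVneq => // <-; rewrite ltnn. Qed.

Lemma fun_tree_subgraph : subgraph_of mu (fun_tree f V s).
Proof.
split=> [|a /= /imsetP[i iV ->]].
  apply/fintype.subsetP => a /imsetP[i iV ->].
  by rewrite arc_in_arcs ?parent_neq //; have [_ /(_ i iV)[]] := fP.
have [_ /(_ i iV)[fiV _ _]] := fP; move: iV; rewrite inE => /andP[_ iV].
by rewrite /arc; case: ifP.
Qed.

Lemma adj_fun_tree x y : adj (fun_tree f V s) x y ->
  (x \in (V :\ s)%SET /\ f x = y) \/ (y \in (V :\ s)%SET /\ f y = x).
Proof.
rewrite adj_arc; last by case: fun_tree_subgraph.
by case/imsetP => i iV /arc_eq[[-> ->]|[-> ->]]; [left|right].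
Qed.

Lemma fun_tree_is_tree : is_tree (fun_tree f V s).
Proof.
have [sV fV] := fP; have [Tsub _] := fun_tree_subgraph.
have to_root x : x \in V -> connect (adj (fun_tree f V s)) x s.
  elim: {x}(r x).+1 {-2}x (ltnSn (r x)) => // k IH x xk xV.
  have [->|xs] := eqVneq x s; first exact: connect0.
  have xVs : x \in (V :\ s)%SET by rewrite !inE xs.
  have [fxV fxr _] := fV x xVs.
  apply: connect_trans (IH (f x) _ fxV); last by apply: leq_trans fxr _; rewrite -ltnS.
  by apply: connect1; rewrite adj_arc //; apply: imset_f.
split=> [|x y xV yV|c csize].
- by apply/set0Pn; exists s.
- apply: connect_trans (to_root x xV) _.
  by rewrite (sym_connect_sym (adj_sym _)) to_root.
(* A vertex of maximal rank on a cycle would have two distinct parents. *)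
apply/negP => /andP[ccyc cuniq].
have /hasP[x0 x0c _] : has predT c by rewrite has_predT (leq_trans _ csize).
case: (@arg_maxnP _ x0 (mem c) r x0c) => x xc xmax.
have parent y : y \in c -> adj (fun_tree f V s) x y -> y = f x.
  move=> yc /adj_fun_tree[[]//|[yV fy]].
  by have [_ + _] := fV y yV; rewrite fy ltnNge => /negP[]; apply: xmax.
(* With [x] rotated to the front, its cycle neighbours are the second and the last vertex; both
   would be [f x]. *)
have [i c' c'E] := rot_to xc.
move: ccyc cuniq csize parent.
rewrite -(rot_cycle i) -(rot_uniq i) -(size_rot i) c'E => ccyc cuniq csize parent.
have {}parent y : y \in x :: c' -> adj (fun_tree f V s) x y -> y = f x.
  by rewrite -c'E mem_rot; apply: parent.
case: c' {c'E} ccyc cuniq csize parent => [|y [|z c']] //.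
rewrite [cycle _ _]/= rcons_path => /andP[xy /andP[_ /andP[_ lx]]] cuniq _ parent.
have yf : y = f x by apply: parent; rewrite ?inE ?eqxx ?orbT.
have lf : last z c' = f x.
  apply: parent; last by rewrite adj_sym.
  by rewrite !inE; have := mem_last z c'; rewrite inE => ->; rewrite !orbT.
by move: cuniq => /= /and3P[_ + _]; rewrite yf -lf mem_last.
Qed.

(** Parent arcs of distinct vertices differ: two vertices that are each other's parent would have
    mutually smaller ranks. *)
Lemma fun_tree_weight :
  tree_weight mu (fun_tree f V s) = \prod_(i in (V :\ s)%SET) mu i (f i).
Proof.
have [_ fV] := fP.
rewrite /tree_weight /= big_imset /=.
  by apply: eq_bigr => i iV; rewrite mu_arc // parent_neq.
move=> i j iV jV /arc_eq[[]//|[ij ji]].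
have [_ ri _] := fV i iV; have [_ rj _] := fV j jV.
by move: ri; rewrite -ij in rj; rewrite ji ltnNge (ltnW rj).
Qed.

End FunTree.

(** Indexing walks by exact length allows a least one to be chosen, which gives the distance to
    [s]. *)
Fixpoint walk T s k x : bool :=
  if k is k'.+1 then [exists y, adj T x y && walk T s k' y] else x == s.

Lemma connect_walk T s x : connect (adj T) x s -> exists k, walk T s k x.
Proof.
case/connectP => p; elim: p x => [|y p IH] x /=; first by move=> _ ->; exists 0%N => /=.
case/andP=> xy /IH/[apply] -[k yk]; exists k.+1; apply/existsP; exists y.
by rewrite xy.
Qed.

(** The rank is the distance to [s] and the parent a neighbour closer to [s]; acyclicity excludes
    any further arc. *)
Lemma tree_parent T s : subgraph_of mu T -> is_tree T -> s \in T.1 ->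
  exists f r, parent_fun f T.1 s r /\ T = fun_tree f T.1 s.
Proof.
move=> [Tsub TV] [_ Tconn Tacyc] sT.
(* Connectedness provides a walk from every vertex of [T.1], so the default rank 0 is never taken
   there; the default parent [x] is taken on [T.1] only at [s]. *)
pose r x := if pselect (exists k, walk T s k x) is left ex then ex_minn ex else 0%N.
pose f := [ffun x => odflt x [pick y | adj T x y && (r y < r x)%N]].
have fadj x : x \in (T.1 :\ s)%SET -> adj T x (f x) && (r (f x) < r x)%N.
  rewrite !inE ffunE => /andP[xs xT]; case: pickP => //= none.
  have ex := connect_walk (Tconn x s xT sT).
  suff [y yP] : exists y, adj T x y && (r y < r x)%N by rewrite none in yP.
  rewrite {2}/r; case: pselect => // ex'; case: ex_minnP => -[|k].
    by rewrite /= (negPf xs).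
  move=> /existsP[y /andP[xy yk]] _; exists y; rewrite xy /= ltnS /r.
  by case: pselect => // ex''; case: ex_minnP => m _; apply.
have fP : parent_fun f T.1 s r.
  split=> // x xT; have /andP[xfx ->] := fadj x xT; move: (xfx).
  rewrite adj_arc // => fxT; have := fintype.subsetP Tsub _ fxT.
  rewrite arc_in_arcs ?(adj_neq Tsub xfx) // => ->; split=> //.
  by have [] := TV _ fxT; rewrite /arc; case: ifP.
exists f, r; split=> //; rewrite [T]surjective_pairing /fun_tree /=; congr (_, _).
have sub : [set arc i (f i) | i in (T.1 :\ s)%SET]%SET \subset T.2.
  apply/fintype.subsetP => a /imsetP[x xT ->].
  by rewrite -adj_arc //; have /andP[] := fadj x xT.
(* An arc outside the parent arcs closes up, with the path of parent arcs
   between its ends, into a simple cycle of [T]. *)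
apply/eqP; rewrite finset.eqEsubset sub andbT; apply/fintype.subsetP => -[x y] xyT.
apply/negPn/negP => xyf; have [xT yT] := TV _ xyT.
have [_ /(_ x y xT yT) /connectP[p0 /shortenP[p pp pu _] yE] _] := fun_tree_is_tree fP.
have xyadj : adj T x y by rewrite /adj xyT.
have := fintype.subsetP Tsub _ xyT; rewrite inE /= => /andP[xy _].
have := Tacyc (x :: p); rewrite /ucycleb pu andbT /= rcons_path -yE adj_sym xyadj andbT.
(* The tree path from [x] to [y] is empty, against x < y, or a single arc, which is then a parent
   arc, or long enough to close a cycle of [T]. *)
move=> acyc; case: p pp pu yE acyc => [|z [|z' p]] pp pu yE acyc.
- by rewrite yE /= ltnn in xy.
- move: pp xyf; rewrite -[z]/(last x [:: z]) -yE /= andbT adj_arc.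
    by rewrite /arc xy /= => ->.
  by have [] := fun_tree_subgraph fP.
- have /negP := acyc isT; apply; apply: sub_path pp => u v.
  by rewrite /adj => /orP[] /(fintype.subsetP sub) ->; rewrite ?orbT.
Qed.

(** The orbit of [i] is at both fixed points after the sum of the two step counts. *)
Lemma fconnect_fix_uniq f s t i :
  f s = s -> f t = t -> fconnect f i s -> fconnect f i t -> s = t.
Proof.
move=> fs ft /iter_findex si /iter_findex ti.
have fix_iter k u : f u = u -> iter k f u = u by move=> fu; elim: k => //= k ->.
by rewrite -(fix_iter (findex f i t) s fs) -{1}si -iterD addnC iterD ti fix_iter.
Qed.

(* If [f] and [g] differ at [i], equality of the arcs forces [g (f i) = i], so
   they differ at [f i] too, which has smaller rank. *)
Lemma rooted_inj S f g : rooted S f -> rooted S g ->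
  (forall i, i \notin S -> exists2 j, j \notin S & arc i (f i) = arc j (g j)) ->
  f = g.
Proof.
move=> /rootedP[fS [r rf]] /rootedP[gS _] arcs_eq; apply/ffunP => i.
apply/eqP; elim: {i}(r i).+1 {-2}i (ltnSn (r i)) => // k IH i ik.
case: (boolP (i \in S)) => [iS|iS]; first by rewrite fS // gS.
have [j jS /arc_eq[[-> ->]//|[ij ji]]] := arcs_eq i iS.
have rj : (r j < r i)%N by rewrite -ji rf.
have /eqP fgj : f j == g j by apply: IH; apply: leq_trans rj _; rewrite -ltnS.
by have := rf j jS; rewrite fgj -ij ltnNge (ltnW rj).
Qed.

(* Unlike in [forests2], both orders of the two trees are kept. *)
Definition is_tree_pair F : Prop :=
  [/\ subgraph_of mu F.1 /\ is_tree F.1, subgraph_of mu F.2 /\ is_tree F.2,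
      [disjoint F.1.1 & F.2.1] & (F.1.1 :|: F.2.1)%SET = [set: 'I_n]%SET].

Definition tree_pairs : {set graph n * graph n} := [set F | `[< is_tree_pair F >]]%SET.

(** For a root [s], the vertex set of the tree hanging from [s]. *)
Definition basin f s : {set 'I_n} := [set x | fconnect f x s]%SET.

Definition fun_forest (h m : 'I_n) f : graph n * graph n :=
  (fun_tree f (basin f h) h, fun_tree f (basin f m) m).

(** * Functions with two roots as ordered pairs of trees *)

Section TwoRoots.
Variables (h m : 'I_n).
Hypothesis hm : h != m.
Let S : {set 'I_n} := [set h; m]%SET.

(** With non-negative weights, the rooted functions left out use an arc of weight 0 and contribute
    nothing to the minor. *)
Definition pos_rooted : {set {ffun 'I_n -> 'I_n}} :=
  [set f | rooted S f && [forall i in (~: S)%SET, 0 < mu i (f i)]]%SET.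

Lemma basin_split f : rooted S f ->
  [/\ f h = h, f m = m, [disjoint basin f h & basin f m] &
      (basin f h :|: basin f m)%SET = [set: 'I_n]%SET].
Proof.
move=> rt; have [fS _] := rootedP _ _ rt.
have fh : f h = h by apply: fS; rewrite !inE eqxx.
have fm : f m = m by apply: fS; rewrite !inE eqxx orbT.
split=> //.
  apply/pred0P => x /=; apply/negP; rewrite !inE => /andP[xh xm].
  by case/eqP: hm; apply: fconnect_fix_uniq xh xm.
apply/setP => x; rewrite !inE; case/andP: rt => _ /forallP/(_ x)/existsP[t].
by rewrite !inE => /andP[/orP[]/eqP-> ->]; rewrite ?orbT.
Qed.

Lemma basinC f : rooted S f ->
  forall x, ((x \in basin f h :\ h)%SET -> x \notin S) /\
            ((x \in basin f m :\ m)%SET -> x \notin S).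
Proof.
move=> rt x; have [fh fm /pred0P dis _] := basin_split rt.
split; rewrite !inE => /andP[/negPf xs xb]; rewrite xs ?orbF /=.
  by apply/eqP => xm; have := dis x; rewrite /= !inE xb xm connect0.
by apply/eqP => xm; have := dis x; rewrite /= !inE xb xm connect0.
Qed.

Lemma pos_rooted_parent f : f \in pos_rooted ->
  exists r, parent_fun f (basin f h) h r /\ parent_fun f (basin f m) m r.
Proof.
rewrite inE => /andP[rt /forall_inP pos]; have [fS [r rf]] := rootedP _ _ rt.
have [fh fm dis _] := basin_split rt.
exists r; split; (split; first by rewrite inE connect0) => i iV.
  have iS : i \notin S by apply: (basinC rt i).1.
  split; [|exact: rf|by apply: pos; rewrite finset.in_setC].
  by move: iV; rewrite !inE fconnect_fix // => /andP[].
have iS : i \notin S by apply: (basinC rt i).2.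
split; [|exact: rf|by apply: pos; rewrite finset.in_setC].
by move: iV; rewrite !inE fconnect_fix // => /andP[].
Qed.

(** The parent arc of [i] under [f] belongs to the tree of [g] with the same root, so it is a parent
    arc of [g] and [rooted_inj] applies. *)
Lemma fun_forest_inj : {in pos_rooted &, injective (fun_forest h m)}.
Proof.
move=> f g; rewrite !inE => /andP[rf _] /andP[rg _] [_ Eh _ Em].
apply: (rooted_inj rf rg) => i iS.
have [_ _ _ /setP/(_ i)] := basin_split rf.
rewrite finset.in_setU finset.in_setT => /orP[ih|im].
  have : arc i (f i) \in [set arc i (f i) | i in (basin f h :\ h)%SET]%SET.
    by apply: imset_f; rewrite in_setD1 ih andbT; apply: contraNneq iS => ->; rewrite !inE eqxx.
  rewrite Eh => /imsetP[j jh ->]; exists j => //.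
  exact: (basinC rg j).1.
have : arc i (f i) \in [set arc i (f i) | i in (basin f m :\ m)%SET]%SET.
  by apply: imset_f; rewrite in_setD1 im andbT; apply: contraNneq iS => ->;
    rewrite !inE eqxx orbT.
rewrite Em => /imsetP[j jm ->]; exists j => //.
exact: (basinC rg j).2.
Qed.

(** Rooting the first tree at [h] and the second at [m] gives two parent functions, which are glued
    into one function fixing both roots. *)
Lemma fun_forest_image :
  (fun_forest h m @: pos_rooted)%SET =
  [set F in tree_pairs | (h \in F.1.1) && (m \in F.2.1)]%SET.
Proof.
apply/setP => F; apply/imsetP/idP => [[f fpos ->]|].
  have [r [ph pm]] := pos_rooted_parent fpos.
  have rt : rooted S f by move: fpos; rewrite inE => /andP[].
  have [_ _ dis cov] := basin_split rt.
  rewrite inE ph.1 pm.1 !andbT inE; apply/asboolP.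
  by split=> //; split; solve [exact: fun_tree_subgraph ph | exact: fun_tree_is_tree ph
    | exact: fun_tree_subgraph pm | exact: fun_tree_is_tree pm].
case: F => T1 T2; rewrite !inE /= => /and3P[/asboolP Fpair hT mT].
case: Fpair => /= [[sub1 tree1] [sub2 tree2] dis cov].
have [f1 [r1 [p1 T1E]]] := tree_parent sub1 tree1 hT.
have [f2 [r2 [p2 T2E]]] := tree_parent sub2 tree2 mT.
have notT2 x : x \in T1.1 -> x \notin T2.1 by move=> xT; rewrite (disjointFr dis xT).
have notT1 x : x \in T2.1 -> x \notin T1.1 by move=> xT; rewrite (disjointFl dis xT).
have T12 x : x \in T1.1 \/ x \in T2.1.
  by have /setP/(_ x) := cov; rewrite finset.in_setU finset.in_setT => /orP.
pose f := [ffun x => if x \in S then x else if x \in T1.1 then f1 x else f2 x].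
pose r x := if x \in T1.1 then r1 x else r2 x.
have fh : f h = h by rewrite ffunE !inE eqxx.
have fm : f m = m by rewrite ffunE !inE eqxx orbT.
have fE1 x : x \in (T1.1 :\ h)%SET -> f x = f1 x.
  rewrite !inE => /andP[/negPf xh xT]; rewrite ffunE !inE xh xT /=.
  by case: eqVneq => // xm; have := notT2 x xT; rewrite xm mT.
have fE2 x : x \in (T2.1 :\ m)%SET -> f x = f2 x.
  rewrite !inE => /andP[/negPf xm xT]; rewrite ffunE !inE xm (negPf (notT1 _ xT)) orbF.
  by case: eqVneq => // xh; have := notT1 x xT; rewrite xh hT.
have inD x : x \notin S -> x \in (T1.1 :\ h)%SET \/ x \in (T2.1 :\ m)%SET.
  by rewrite !inE negb_or => /andP[-> ->]; apply: T12.
have rf x : x \notin S -> (r (f x) < r x)%N.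
  case/inD=> xT.
    have [fT rx _] := p1.2 x xT; rewrite fE1 // /r fT.
    by move: xT; rewrite !inE => /andP[_ ->].
  have [fT rx _] := p2.2 x xT; rewrite fE2 // /r (negPf (notT1 _ fT)).
  by move: xT; rewrite !inE => /andP[_ /notT1/negPf->].
have rt : rooted S f.
  by apply/rootedP; split; [move=> x xS; rewrite ffunE xS | exists r].
have to_h x : x \in T1.1 -> fconnect f x h.
  elim: {x}(r x).+1 {-2}x (ltnSn (r x)) => // k IH x xk xT.
  have [->|xh] := eqVneq x h; first exact: connect0.
  have xTh : x \in (T1.1 :\ h)%SET by rewrite !inE xh.
  have xS : x \notin S.
    by rewrite !inE (negPf xh) /=; apply: contraNneq (notT2 x xT) => ->.
  rewrite -fconnect_fix //; apply: IH; first by apply: leq_trans (rf x xS) _; rewrite -ltnS.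
  by rewrite fE1 //; have [] := p1.2 x xTh.
have to_m x : x \in T2.1 -> fconnect f x m.
  elim: {x}(r x).+1 {-2}x (ltnSn (r x)) => // k IH x xk xT.
  have [->|xm] := eqVneq x m; first exact: connect0.
  have xTm : x \in (T2.1 :\ m)%SET by rewrite !inE xm.
  have xS : x \notin S.
    by rewrite !inE (negPf xm) orbF; apply: contraNneq (notT1 x xT) => ->.
  rewrite -fconnect_fix //; apply: IH; first by apply: leq_trans (rf x xS) _; rewrite -ltnS.
  by rewrite fE2 //; have [] := p2.2 x xTm.
have [_ _ bdis _] := basin_split rt.
(* Each tree lies in the basin of its root; as the trees cover all vertices and the basins are
   disjoint, equality follows. *)
have bh : basin f h = T1.1.
  apply/setP => x; case: (T12 x) => xT; first by rewrite xT inE to_h.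
  rewrite (negPf (notT1 _ xT)); apply/negP => xh.
  by have := disjointFr bdis xh; rewrite inE to_m.
have bm : basin f m = T2.1.
  apply/setP => x; case: (T12 x) => xT; last by rewrite xT inE to_m.
  rewrite (negPf (notT2 _ xT)); apply/negP => xm.
  by have := disjointFl bdis xm; rewrite inE to_h.
exists f; last first.
  rewrite /fun_forest bh bm T1E T2E /fun_tree /=; congr ((_, _), (_, _)).
    by apply: eq_in_imset => x xT; rewrite fE1.
  by apply: eq_in_imset => x xT; rewrite fE2.
rewrite inE rt /=; apply/forall_inP => x; rewrite inE => /inD[] xT.
  by rewrite fE1 //; have [] := p1.2 x xT.
by rewrite fE2 //; have [] := p2.2 x xT.
Qed.

Hypothesis mu_ge0 : forall i j : 'I_n, i != j -> 0 <= mu i j.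

(** The vertices outside [S] split along the two basins, so the product of the weights factors into
    the two tree weights. *)
Lemma det_del2_transition_mx :
  \det (del_mx S (transition_mx mu)) =
  \sum_(F in tree_pairs | (h \in F.1.1) && (m \in F.2.1))
    tree_weight mu F.1 * tree_weight mu F.2.
Proof.
rewrite det_del_transition_mx.
transitivity (\sum_(f in pos_rooted) \prod_(i in (~: S)%SET) mu i (f i)).
  rewrite big_mkcond [RHS]big_mkcond; apply: eq_bigr => f _; rewrite inE.
  case: (boolP (rooted S f)) => //= rt; case: (boolP [forall _ in _, _]) => //.
  rewrite negb_forall => /existsP[i]; rewrite negb_imply inE => /andP[iS].
  rewrite lt_def negb_and negbK mu_ge0 ?orbF => [/eqP mui0|].
    by rewrite (bigD1 i) ?finset.in_setC //= mui0 mul0r.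
  by rewrite eq_sym (rooted_neq rt).
rewrite (eq_bigl (mem [set F in tree_pairs | (h \in F.1.1) && (m \in F.2.1)]%SET)); last first.
  by move=> F; rewrite /= !inE.
rewrite -fun_forest_image big_imset /=; last exact: fun_forest_inj.
apply: eq_bigr => f fpos; have [r [ph pm]] := pos_rooted_parent fpos.
have rt : rooted S f by move: fpos; rewrite inE => /andP[].
have [_ _ dis cov] := basin_split rt.
rewrite (fun_tree_weight ph) (fun_tree_weight pm).
rewrite -bigU /=; last first.
  exact: disjointWl (subD1set _ _) (disjointWr (subD1set _ _) dis).
apply: eq_bigl => i; apply/idP/idP.
  rewrite !inE negb_or => /andP[-> ->]; have /setP/(_ i) := cov.
  by rewrite !inE.
by rewrite finset.in_setC => /orP[] iV; [apply: (basinC rt i).1 | apply: (basinC rt i).2].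
Qed.

End TwoRoots.

End Trees.
(** * First principal minors of the transition matrix *)

(** The matrix determinant lemma, from two block triangular factorizations of one matrix. *)
Lemma det_1D_rank1 (R : comNzRingType) (n : nat) (y : 'cV[R]_n) (z : 'rV[R]_n) :
  \det (1%:M + y *m z) = 1 + (z *m y) 0 0.
Proof.
have E : block_mx 1%:M 0 y 1%:M *m block_mx 1%:M (- z) 0 (1%:M + y *m z) =
         block_mx (1%:M + z *m y) (- z) 0 1%:M *m block_mx 1%:M 0 y 1%:M.
  rewrite !mulmx_block !mulmx1 !mul1mx !mulmx0 !mul0mx !mulNmx !mulmxN.
  by rewrite !addr0 !add0r addrK [1%:M + _]addrC addKr.
have := congr1 determinant E.
by rewrite !det_mulmx !det_ublock !det_lblock !det1 !mul1r !mulr1 det_mx11 !mxE eqxx.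
Qed.

Section TransitionMinors.
Variables (R : realType) (n : nat) (mu : 'I_n -> 'I_n -> R).
Hypothesis mu_sym : forall i j : 'I_n, i != j -> mu i j = mu j i.
Let B := transition_mx mu.

Lemma transition_mx_tr : B^T = B.
Proof.
apply/matrixP => i j; rewrite !mxE eq_sym; case: eqVneq => [->//|ij].
by rewrite mu_sym // eq_sym.
Qed.

Lemma transition_mx_colsum : const_mx 1 *m B = 0 :> 'rV[R]_n.
Proof.
apply/trmx_inj; rewrite trmx_mul transition_mx_tr trmx0.
apply/matrixP => i j; rewrite !mxE (bigD1 i) //= !mxE eqxx mulr1.
rewrite -big_split /= big1 // => k ki.
by rewrite !mxE eq_sym (negPf ki) mulr1 subrr.
Qed.

Lemma det_del0_transition_mx : (0 < n)%N -> \det (del_mx finset.set0 B) = 0.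
Proof.
move=> n_gt0; rewrite det_del_transition_mx big_pred0 // => f.
apply/negP => /andP[_ /forallP/(_ (Ordinal n_gt0))/existsP[s]].
by rewrite inE.
Qed.

Lemma det_add_delta_row (i j k : 'I_n) :
  \det (B + delta_mx i k) = \det (B + delta_mx j k).
Proof.
(* Left multiplication by [1 + (e_i - e_j) 1^T], of determinant [1], fixes [B] and
   moves [e_j] to [e_i]. *)
pose y : 'cV[R]_n := delta_mx i 0 - delta_mx j 0.
pose e : 'rV[R]_n := const_mx 1.
have -> : B + delta_mx i k = (1%:M + y *m e) *m (B + delta_mx j k).
  have ejk : e *m delta_mx j k = delta_mx 0 k.
    apply/matrixP => a b; rewrite !mxE (bigD1 j) //= !mxE !eqxx mul1r big1 => [|l lj].
      by rewrite addr0 ord1.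
    by rewrite !mxE (negPf lj) mulr0.
  rewrite mulmxDl mul1mx -mulmxA mulmxDr transition_mx_colsum add0r ejk mulmxBl.
  by rewrite !mul_delta_mx -addrA; congr (_ + _); rewrite addrC subrK.
have ey : e *m y = 0.
  apply/matrixP => a b; rewrite mulmxBr !mxE.
  have sum1 l : \sum_p e a p * (delta_mx l 0 : 'cV[R]_n) p b = 1.
    rewrite (bigD1 l) //= !mxE !ord1 !eqxx mulr1 big1 ?addr0 // => p pl.
    by rewrite !mxE (negPf pl) mulr0.
  by rewrite !sum1 subrr.
by rewrite det_mulmx det_1D_rank1 ey mxE addr0 mul1r.
Qed.

(** In the expansion along the diagonal e_i only the empty set and {i} survive, and the empty set
    contributes det B = 0. *)
Lemma det_add_delta_diag (i : 'I_n) :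
  \det (B + delta_mx i i) = \det (del_mx [set i]%SET B).
Proof.
have n_gt0 : (0 < n)%N := leq_ltn_trans (leq0n i) (ltn_ord i).
have -> : B + delta_mx i i = diag_mx (delta_mx 0 i) + B.
  rewrite addrC; congr (_ + _); apply/matrixP => j k; rewrite !mxE eqxx /=.
  by case: (eqVneq j i) => [->|_] /=; rewrite ?mul0rn // [k == i]eq_sym; case: eqVneq.
rewrite det_diag_add (bigD1 [set i]%SET) //= big_set1 mxE !eqxx mul1r.
rewrite (bigD1 finset.set0) /=; last by rewrite eq_sym; apply/set0Pn; exists i; rewrite inE.
rewrite det_del0_transition_mx // mulr0 add0r big1 ?addr0 // => S /andP[Si S0].
suff [j jS ji] : exists2 j, j \in S & j != i.
  by rewrite (bigD1 j) //= mxE (negPf ji) andbF !mul0r.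
apply/exists_inP; apply: contraNT Si; rewrite negb_exists_in => /forall_inP Si.
rewrite finset.eqEsubset; apply/andP; split.
  by apply/fintype.subsetP => j /Si; rewrite negbK inE.
have /set0Pn[j jS] := S0.
by rewrite finset.sub1set; have := Si j jS; rewrite negbK => /eqP <-.
Qed.

(** The added unit entry moves from (i, i) to (j, i) by a row change, to (i, j) by transposition,
    and to (j, j) by a row change. *)
Lemma det_del1_const (i j : 'I_n) :
  \det (del_mx [set i]%SET B) = \det (del_mx [set j]%SET B).
Proof.
rewrite -!det_add_delta_diag (det_add_delta_row i j).
rewrite -det_tr linearD /= transition_mx_tr trmx_delta.
exact: det_add_delta_row.
Qed.

Lemma I1_const (i : 'I_n) : I1 B = \det (del_mx [set i]%SET B) *+ n.
Proof.
rewrite /I1 (eq_bigr (fun=> \det (del_mx [set i]%SET B))) => [|j _]; last exact: det_del1_const.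
by rewrite sumr_const card_ord.
Qed.

Lemma I1_ge0 (mu_ge0 : forall i j : 'I_n, i != j -> 0 <= mu i j) : 0 <= I1 B.
Proof.
apply: sumr_ge0 => i _; rewrite det_del_transition_mx.
apply: sumr_ge0 => f rf; apply: prodr_ge0 => j; rewrite inE => jS.
by rewrite mu_ge0 // eq_sym (rooted_neq rf).
Qed.

End TransitionMinors.
(** * Second order derivatives of a form in vanishing functions *)

Section SecondOrder.
Variables (R : realType) (d n : nat).
Implicit Types (k u w : 'rV[R]_d) (S : {set 'I_n}) (g : 'I_n -> 'rV[R]_d -> R).

Lemma is_derive_bigsum (I : Type) (s : seq I) (P : pred I)
    (h : I -> 'rV[R]_d -> R) (dh : I -> R) k u :
  (forall i, P i -> is_derive k u (h i) (dh i)) ->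
  is_derive k u (fun x => \sum_(i <- s | P i) h i x) (\sum_(i <- s | P i) dh i).
Proof.
move=> hP; elim: s => [|i s IH].
  rewrite big_nil (_ : (fun x => _) = cst 0); first exact: is_derive_cst.
  by apply/funext => x; rewrite big_nil.
rewrite big_cons (_ : (fun x => _) =
    fun x => if P i then h i x + \sum_(i <- s | P i) h i x else \sum_(i <- s | P i) h i x).
  by case: ifP => // Pi; apply: is_deriveD => //; apply: hP.
by apply/funext => x; rewrite big_cons.
Qed.

Lemma is_derive_mul (f h : 'rV[R]_d -> R) (df dh : R) k u :
  is_derive k u f df -> is_derive k u h dh ->
  is_derive k u (fun x => f x * h x) (df * h k + f k * dh).
Proof.
move=> fP hP; apply: (@is_derive_eq _ _ _ _ _ _ _ _ (is_deriveM fP hP)).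
by rewrite addrC /GRing.scale /= [h k * _]mulrC.
Qed.

(** The Leibniz rule, in a form without division by [g i k], since it is applied where all factors
    vanish. *)
Lemma is_derive_prod g (dg : 'I_n -> R) S k u :
  (forall i, i \in S -> is_derive k u (g i) (dg i)) ->
  is_derive k u (fun x => \prod_(i in S) g i x)
    (\sum_(i in S) dg i * \prod_(j in (S :\ i)%SET) g j k).
Proof.
elim: {S}#|S| {-2}S (erefl #|S|) => [|m IH] S cS gS.
  move/eqP: cS; rewrite cards_eq0 => /eqP ->.
  rewrite big_set0 (_ : (fun x => _) = cst 1); first exact: is_derive_cst.
  by apply/funext => x; rewrite big_set0.
have /set0Pn[a aS] : S != finset.set0 by rewrite -card_gt0 cS.
have -> : (fun x => \prod_(i in S) g i x) =
    (fun x => g a x * \prod_(i in (S :\ a)%SET) g i x).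
  by apply/funext => x; rewrite (big_setD1 a).
have cSa : #|(S :\ a)%SET| = m by move: cS; rewrite (cardsD1 a) aS add1n => -[].
have gSa i : i \in (S :\ a)%SET -> is_derive k u (g i) (dg i).
  by rewrite !inE => /andP[_ /gS].
apply: is_derive_eq (is_derive_mul (gS a aS) (IH _ cSa gSa)) _.
rewrite [RHS](big_setD1 a) //=; congr (_ + _); rewrite mulr_sumr; apply: eq_bigr => i.
rewrite !inE => /andP[ia iS]; rewrite mulrCA; congr (_ * _).
rewrite [RHS](big_setD1 a) ?inE ?aS 1?eq_sym ?ia //=; congr (_ * _).
by rewrite !finset.setDDl finset.setUC.
Qed.

Lemma prod_vanish g S k : (forall i, g i k = 0) ->
  \prod_(i in S) g i k = (S == finset.set0)%:R.
Proof.
move=> g0; case: (set_0Vmem S) => [->|[a aS]]; first by rewrite big_set0 eqxx.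
rewrite (bigD1 a) //= g0 mul0r; case: eqVneq => // S0.
by rewrite S0 inE in aS.
Qed.

Lemma sum_pick1 (C : {set 'I_n} -> R) (X : 'I_n -> R) :
  \sum_(S : {set 'I_n}) C S * (\sum_(i in S) X i * ((S :\ i)%SET == finset.set0)%:R) =
  \sum_i C [set i]%SET * X i.
Proof.
under eq_bigr do rewrite mulr_sumr big_mkcond.
rewrite exchange_big /=; apply: eq_bigr => i _.
rewrite (bigD1 [set i]%SET) //= set11 finset.setDv eqxx mulr1 big1 ?addr0 // => S Si.
case: ifP => // iS; case: eqVneq; rewrite ?mulr0 // => S0.
by case/eqP: Si; rewrite -(finset.setD1K iS) S0 finset.setU0.
Qed.

(** The indicator leaves only two-element sets, each met twice, once for either order of removal. *)
Lemma sum_pick2 (C : {set 'I_n} -> R) (X : 'I_n -> 'I_n -> R) :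
  \sum_(S : {set 'I_n}) C S *
    (\sum_(i in S) \sum_(j in (S :\ i)%SET)
       X i j * ((S :\ i :\ j)%SET == finset.set0)%:R) =
  \sum_i \sum_(j | j != i) C [set i; j]%SET * X i j.
Proof.
under eq_bigr do rewrite mulr_sumr big_mkcond.
rewrite exchange_big /=; apply: eq_bigr => i _.
transitivity (\sum_(S : {set 'I_n}) \sum_(j | j != i)
   if (i \in S) && (j \in S) then C S * (X i j * ((S :\ i :\ j)%SET == finset.set0)%:R) else 0).
  apply: eq_bigr => S _; case: ifP => iS /=; last by rewrite big1.
  rewrite mulr_sumr [LHS]big_mkcond [RHS]big_mkcond; apply: eq_bigr => j _.
  by rewrite !inE; case: eqVneq.
rewrite exchange_big /=; apply: eq_bigr => j ji.
rewrite (bigD1 [set i; j]%SET) //= !inE !eqxx orbT /=.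
have -> : ([set i; j] :\ i :\ j)%SET = finset.set0.
  by apply/setP => x; rewrite !inE; case: (x == i); case: (x == j).
rewrite eqxx mulr1 big1 ?addr0 // => S Sij.
case: ifP => // /andP[iS jS]; case: eqVneq; rewrite ?mulr0 // => S0.
case/eqP: Sij; rewrite -(finset.setD1K iS).
have jSi : j \in (S :\ i)%SET by rewrite !inE ji.
by rewrite -(finset.setD1K jSi) S0 finset.setU0.
Qed.

(** Each derivative removes at most one vanishing factor, so at 0 only singletons contribute to the
    first and only sets of at most two elements to the second. The formula along [u] is proved near
    0, so that it can be differentiated along [w]. *)
Lemma vanishing_form_derivatives (C : {set 'I_n} -> R) g u w :
  (forall i, g i 0 = 0) ->
  (\forall k \near (0 : 'rV[R]_d), forall i, derivable (g i) k u) ->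
  (forall i, derivable (g i) 0 w) ->
  (forall i, derivable ('D_u (g i)) 0 w) ->
  (\forall k \near (0 : 'rV[R]_d), \sum_(S : {set 'I_n}) C S * \prod_(i in S) g i k = 0) ->
  \sum_i C [set i]%SET * 'D_u (g i) 0 = 0 /\
  \sum_i C [set i]%SET * 'D_w ('D_u (g i)) 0 +
  \sum_i \sum_(j | j != i) C [set i; j]%SET * ('D_u (g i) 0 * 'D_w (g j) 0) = 0.
Proof.
move=> g0 gu gw guw Phi0.
pose Phi k := \sum_(S : {set 'I_n}) C S * \prod_(i in S) g i k.
pose DPhi k := \sum_(S : {set 'I_n}) C S *
  \sum_(i in S) 'D_u (g i) k * \prod_(j in (S :\ i)%SET) g j k.
have DPhiE : \forall k \near (0 : 'rV[R]_d), 'D_u Phi k = DPhi k.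
  near=> k.
  have gk i : is_derive k u (g i) ('D_u (g i) k).
    by apply/derivableP; move: i; near: k.
  suff [] : is_derive k u Phi (DPhi k) by [].
  apply: is_derive_bigsum => S _.
  apply: is_derive_eq (is_derive_mul (is_derive_cst (C S) k u)
    (is_derive_prod (fun i _ => gk i))) _.
  by rewrite mul0r add0r.
have DPhi0 : \forall k \near (0 : 'rV[R]_d), DPhi k = 0.
  (* The form vanishes around every point close to 0, hence so does its derivative along [u] at such
     a point. *)
  have Phi00 := near_join Phi0.
  near=> k; rewrite -(near DPhiE k) // (@near_eq_derive _ _ _ Phi (cst 0)).
    exact: derive_cst.
  by near: k.
split.
  rewrite -sum_pick1 -[RHS](nbhs_singleton DPhi0).
  apply: eq_bigr => S _; congr (_ * _); apply: eq_bigr => i _.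
  by rewrite prod_vanish.
have : 'D_w DPhi 0 = 0.
  by rewrite (near_eq_derive _ DPhi0) derive_cst.
have gw' i : is_derive (0 : 'rV[R]_d) w (g i) ('D_w (g i) 0) by apply/derivableP.
have guw' i : is_derive (0 : 'rV[R]_d) w ('D_u (g i)) ('D_w ('D_u (g i)) 0).
  exact/derivableP.
have [_ ->] : is_derive (0 : 'rV[R]_d) w DPhi
  (\sum_(S : {set 'I_n}) C S * (\sum_(i in S)
     ('D_w ('D_u (g i)) 0 * \prod_(j in (S :\ i)%SET) g j 0 +
      'D_u (g i) 0 * \sum_(j in (S :\ i)%SET)
        'D_w (g j) 0 * \prod_(l in (S :\ i :\ j)%SET) g l 0))).
  apply: is_derive_bigsum => S _.
  apply: is_derive_eq (is_derive_mul (is_derive_cst (C S) 0 w) _) _; last first.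
    by rewrite mul0r add0r.
  apply: is_derive_bigsum => i _; apply: is_derive_mul => //.
  exact: is_derive_prod.
under eq_bigr => S _.
  under eq_bigr => i _.
    rewrite prod_vanish // mulr_sumr.
    under eq_bigr do rewrite prod_vanish // mulrA.
    over.
  rewrite big_split /= mulrDr.
  over.
by rewrite big_split /= sum_pick1 sum_pick2.
Unshelve. all: by end_near. Qed.

End SecondOrder.
(** * The diffusion matrix *)

Section DiffusionMatrix.
Variables (R : realType) (n d : nat) (v : 'I_n -> 'rV[R]_d).
Variable mu : 'I_n -> 'I_n -> R.

Lemma is_derive_dotp (a k u : 'rV[R]_d) : is_derive k u (dotp a) (dotp a u).
Proof.
apply: is_derive_bigsum => j _.
have coordP : is_derive k u (fun x : 'rV[R]_d => x 0 j) (u 0 j).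
  apply: DeriveDef; first exact/diff_derivable/differentiable_coord.
  have lin : linear (fun x : 'rV[R]_d => x 0 j) by move=> c x y; rewrite !mxE.
  pose c : {linear 'rV[R]_d -> R} :=
    HB.pack (fun x : 'rV[R]_d => x 0 j) (GRing.isLinear.Build _ _ _ _ _ lin).
  rewrite deriveE; last exact: differentiable_coord.
  rewrite (_ : (fun x => _) = c) // diff_lin //.
  exact: coord_continuous.
apply: is_derive_eq (is_derive_mul (is_derive_cst (a 0 j) k u) coordP) _.
by rewrite mul0r add0r.
Qed.

Lemma dotp_delta (a : 'rV[R]_d) (j : 'I_d) : dotp a (delta_mx 0 j) = a 0 j.
Proof.
rewrite /dotp (bigD1 j) //= mxE !eqxx mulr1 big1 ?addr0 // => l lj.
by rewrite mxE (negPf lj) andbF mulr0.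
Qed.

Lemma dotp_suml (I : finType) (P : pred I) (a : I -> 'rV[R]_d) (k : 'rV[R]_d) :
  dotp (\sum_(i | P i) a i) k = \sum_(i | P i) dotp (a i) k.
Proof.
by rewrite /dotp exchange_big /=; apply: eq_bigr => j _; rewrite summxE mulr_suml.
Qed.

Lemma sum_pairs_lt (V : nmodType) (X : 'I_n -> 'I_n -> V) :
  \sum_i \sum_(j | j != i) X i j =
  \sum_(i < n) \sum_(j < n | (i < j)%N) (X i j + X j i).
Proof.
under [RHS]eq_bigr do rewrite big_split /=.
rewrite big_split /= [X in _ + X](exchange_big_dep xpredT) //= -big_split /=.
apply: eq_bigr => i _; rewrite (bigID (fun j : 'I_n => (i < j)%N)) /=.
by congr (_ + _); apply: eq_bigl => j; rewrite -(inj_eq val_inj) /=; case: ltngtP.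
Qed.

Let B := transition_mx mu.

(** Since det B(h, m) is symmetric in h and m, the factor 2 and the symmetric parts combine into a
    sum over ordered pairs. *)
Lemma diffusion_mxE :
  diffusion_mx v mu =
  - (I1 B)^-1 *: \sum_h \sum_(m | m != h) \det (del_mx [set h; m]%SET B) *: tensor (v h) (v m).
Proof.
rewrite /diffusion_mx sum_pairs_lt -/B.
rewrite (_ : - (2 / I1 B) = - (I1 B)^-1 * 2); last by ring.
rewrite -scalerA; congr (_ *: _); rewrite scaler_sumr; apply: eq_bigr => h _.
rewrite scaler_sumr; apply: eq_bigr => m _.
rewrite [[set m; h]%SET]finset.setUC -scalerDr /sym_part scalerA [2 * _]mulrC -scalerA.
congr (_ *: _); rewrite scalerA divff ?scale1r ?pnatr_eq0 //; congr (_ + _).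
by apply/matrixP => j l; rewrite !mxE mulrC.
Qed.

Hypothesis mu_sym : forall i j : 'I_n, i != j -> mu i j = mu j i.
Hypothesis sum_v : \sum_(i < n) v i = 0.

Lemma smooth_branch_hessian (n_gt0 : (0 < n)%N) (I1_neq0 : I1 B != 0) lam :
  smooth_branch v mu lam -> hessian lam 0 = diffusion_mx v mu.
Proof.
move=> [lam0 lam_smooth lam_root].
(* The diagonal entries [g i] vanish at 0, and [C] gives the coefficients of the characteristic
   determinant as a form in them. *)
pose g i k := lam k + dotp (v i) k.
pose C S := \det (del_mx S B).
have lam_near u : \forall k \near (0 : 'rV[R]_d), derivable lam k u.
  near=> k; apply: diff_derivable.
  have : forall s : seq 'rV[R]_d, differentiable (iter_derive s lam) k by near: k.
  by move=> /(_ [::]).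
have lam_u u w : derivable ('D_u lam) 0 w.
  by apply: diff_derivable; have := nbhs_singleton lam_smooth [:: u].
have g_near u : \forall k \near (0 : 'rV[R]_d),
    forall i, is_derive k u (g i) ('D_u lam k + dotp (v i) u).
  near=> k; have lam_k : derivable lam k u by near: k; apply: lam_near.
  by move=> i; apply: is_deriveD; [exact/derivableP | exact: is_derive_dotp].
have gE u i : 'D_u (g i) 0 = 'D_u lam 0 + dotp (v i) u.
  by have [_ ->] := nbhs_singleton (g_near u) i.
have guE u w i : is_derive (0 : 'rV[R]_d) w ('D_u (g i)) ('D_w ('D_u lam) 0).
  (* Near 0 the derivatives of [g i] and [lam] along [u] differ by a constant. *)
  apply: (@near_eq_is_derive _ _ _ (fun k => 'D_u lam k + cst (dotp (v i) u) k)).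
    by apply: filterS (g_near u) => k gk; have [_ ->] := gk i.
  rewrite -[X in is_derive _ _ _ X]addr0; apply: is_deriveD.
  exact/derivableP.
have form u w := @vanishing_form_derivatives R d n C g u w.
have {}form u w : \sum_i C [set i]%SET * 'D_u (g i) 0 = 0 /\
    \sum_i C [set i]%SET * 'D_w ('D_u (g i)) 0 +
    \sum_i \sum_(j | j != i) C [set i; j]%SET * ('D_u (g i) 0 * 'D_w (g j) 0) = 0.
  apply: form.
  - by move=> i; rewrite /g lam0 add0r /dotp big1 // => j _; rewrite mxE mulr0.
  - by apply: filterS (g_near u) => k gk i; have [] := gk i.
  - by move=> i; have [] := nbhs_singleton (g_near w) i.
  - by move=> i; have [] := guE u w i.
  near=> k; transitivity (char_fun v mu (lam k) k); last by near: k.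
  rewrite /char_fun -/B (_ : _%:M + _ = diag_mx (\row_i g i k)).
    by rewrite det_diag_add; apply: eq_bigr => S _; rewrite mulrC; congr (_ * _);
      apply: eq_bigr => i _; rewrite mxE.
  by apply/matrixP => i j; rewrite !mxE -mulrnDl.
have i0 : 'I_n := Ordinal n_gt0.
have c0 : C [set i0]%SET *+ n != 0 by rewrite -(I1_const mu_sym).
have CE i : C [set i]%SET = C [set i0]%SET by apply: det_del1_const.
(* The equal first minors add up to I_1 and the velocities to 0, so the first order identity reads
   I_1 times ['D_u lam 0] equals 0. *)
have drift u : 'D_u lam 0 = 0.
  have [+ _] := form u u.
  under eq_bigr do rewrite CE gE.
  rewrite -mulr_sumr big_split /= sumr_const card_ord -dotp_suml sum_v.
  rewrite /dotp [X in _ + X]big1 ?addr0 => [|j _]; last by rewrite mxE mul0r.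
  rewrite mulrnAr -mulrnAl => /eqP.
  by rewrite mulf_eq0 (negPf c0) => /eqP.
apply/matrixP => j l.
have [_] := form (delta_mx 0 l) (delta_mx 0 j).
under eq_bigr => i _.
  rewrite CE; have [_ ->] := guE (delta_mx 0 l) (delta_mx 0 j) i.
  over.
rewrite sumr_const card_ord -mulrnAl -(I1_const mu_sym) -/B.
move/eqP; rewrite addr_eq0 => /eqP HE.
rewrite mxE -[LHS](mulKf I1_neq0) HE diffusion_mxE !mxE mulrN mulNr; congr (- (_ * _)).
(* The form yields the coordinates l and j in the opposite order to [tensor]; exchanging the two
   summations matches them. *)
rewrite summxE (exchange_big_dep xpredT) //=; apply: eq_bigr => h _; rewrite summxE.
apply: eq_big => [m|m mh]; first by rewrite eq_sym.
by rewrite !gE !drift !add0r !dotp_delta !mxE finset.setUC [v m 0 _ * _]mulrC.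
Unshelve. all: by end_near. Qed.

Hypothesis mu_ge0 : forall i j : 'I_n, i != j -> 0 <= mu i j.

(** * Forest formula and non-negativity *)

Lemma tensor_suml (I : finType) (P : pred I) (a : I -> 'rV[R]_d) (b : 'rV[R]_d) :
  tensor (\sum_(i | P i) a i) b = \sum_(i | P i) tensor (a i) b.
Proof.
apply/matrixP => j l; rewrite !mxE !summxE mulr_suml.
by apply: eq_bigr => i _; rewrite mxE.
Qed.

Lemma tensor_sumr (I : finType) (P : pred I) (a : 'rV[R]_d) (b : I -> 'rV[R]_d) :
  tensor a (\sum_(i | P i) b i) = \sum_(i | P i) tensor a (b i).
Proof.
apply/matrixP => j l; rewrite !mxE !summxE mulr_sumr.
by apply: eq_bigr => i _; rewrite mxE.
Qed.

Definition pair_weight (F : graph n * graph n) : R :=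
  tree_weight mu F.1 * tree_weight mu F.2.

(** By bilinearity both sides sum over triples of a tree pair, a vertex h of its first tree and a
    vertex m of its second; disjointness excludes m = h. *)
Lemma sum_det_del2_tensor :
  \sum_h \sum_(m | m != h) \det (del_mx [set h; m]%SET B) *: tensor (v h) (v m) =
  \sum_(F in tree_pairs mu) pair_weight F *: tensor (tree_velocity v F.1) (tree_velocity v F.2).
Proof.
under [RHS]eq_bigr => F FP.
  rewrite tensor_suml scaler_sumr big_mkcond /=.
  under eq_bigr do rewrite tensor_sumr scaler_sumr big_mkcond /=.
  over.
rewrite [RHS]exchange_big /=; apply: eq_bigr => h _.
transitivity (\sum_(F in tree_pairs mu) \sum_(m | m != h)
   if (h \in F.1.1) && (m \in F.2.1) then pair_weight F *: tensor (v h) (v m) else 0).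
  rewrite [RHS]exchange_big /=; apply: eq_bigr => m mh.
  rewrite (det_del2_transition_mx mu_sym _ mu_ge0) 1?eq_sym // scaler_suml.
  by rewrite big_mkcondr.
apply: eq_bigr => F; rewrite inE => /asboolP[_ _ dis _].
case: ifP => hF /=; last by rewrite big1.
rewrite [RHS](bigD1 h) //= (disjointFr dis hF) add0r.
by apply: eq_bigr => m _.
Qed.

Lemma tree_pair_velocity F : F \in tree_pairs mu ->
  tree_velocity v F.2 = - tree_velocity v F.1.
Proof.
rewrite inE => /asboolP[_ _ dis cov]; apply/eqP; rewrite -addr_eq0 addrC.
apply/eqP; rewrite /tree_velocity -bigU //= -[RHS]sum_v; apply: eq_bigl => i.
by have /setP/(_ i) := cov; rewrite !inE.
Qed.

Definition swap_pair (F : graph n * graph n) : graph n * graph n := (F.2, F.1).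

Lemma swap_pairK : involutive swap_pair. Proof. by case. Qed.

Lemma swap_tree_pairs F : (swap_pair F \in tree_pairs mu) = (F \in tree_pairs mu).
Proof.
rewrite !inE; apply/asboolP/asboolP => -[T1 T2 dis cov]; split=> //=.
- by rewrite disjoint_sym.
- by rewrite finset.setUC.
- by rewrite disjoint_sym.
- by rewrite finset.setUC.
Qed.

Lemma forests2E (i0 : 'I_n) F : i0 = 0%N :> nat ->
  (F \in forests2 mu) = (F \in tree_pairs mu) && (i0 \in F.1.1).
Proof.
move=> i00; rewrite !inE; apply/asboolP/andP => [[T1 T2 dis cov [i iF i_0]]|].
  split; first exact/asboolP.
  by rewrite (_ : i0 = i) //; apply: ord_inj; rewrite i00 i_0.
by case=> /asboolP[T1 T2 dis cov] i0F; split=> //; exists i0.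
Qed.

(** The sign in w(T^2) = - w(T^1) cancels the minus sign of [diffusion_mxE]. The summand is
    invariant under swapping the trees, so ordered pairs count every forest twice, whence the factor
    2. *)
Lemma diffusion_mx_forests (n_gt0 : (0 < n)%N) :
  diffusion_mx v mu =
  (2 / I1 B) *: \sum_(F in forests2 mu)
    pair_weight F *: tensor (tree_velocity v F.1) (tree_velocity v F.1).
Proof.
pose i0 := Ordinal n_gt0.
pose t F := pair_weight F *: tensor (tree_velocity v F.1) (tree_velocity v F.1).
have swap_t F : F \in tree_pairs mu -> t (swap_pair F) = t F.
  move=> FP; rewrite /t /pair_weight /= mulrC tree_pair_velocity //; congr (_ *: _).
  by apply/matrixP => j l; rewrite !mxE mulrNN.
rewrite diffusion_mxE sum_det_del2_tensor.
rewrite (eq_bigr (fun F => - t F)) => [|F FP]; last first.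
  rewrite tree_pair_velocity // -scalerN; congr (_ *: _).
  by apply/matrixP => j l; rewrite !mxE mulrN.
rewrite sumrN scaleNr scalerN opprK [2 * _]mulrC -scalerA; congr (_ *: _).
rewrite scaler_nat mulr2n (eq_bigl _ _ (fun F => forests2E F (erefl : i0 = 0%N :> nat))).
(* Pairs are split by the tree that contains [i0]; the swap carries one class onto the other. *)
rewrite [LHS](bigID (fun F : graph n * graph n => i0 \in F.1.1)) /=; congr (_ + _).
rewrite (reindex_inj (inv_inj swap_pairK)) /=.
apply: eq_big => [F|F /andP[FP _]]; last by rewrite -[RHS]swap_t // -swap_tree_pairs.
rewrite swap_tree_pairs; case: (boolP (F \in tree_pairs mu)) => //=.
rewrite inE => /asboolP[_ _ dis cov].
have /setP/(_ i0) := cov; rewrite !inE; case: (boolP (i0 \in F.1.1)) => /= i0F.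
  by rewrite (disjointFr dis i0F).
by move=> ->.
Qed.

Lemma quadratic_tensor (a x : 'rV[R]_d) :
  \sum_(j < d) \sum_(l < d) x 0 j * tensor a a j l * x 0 l = dotp x a ^+ 2.
Proof.
rewrite expr2 /dotp mulr_suml; apply: eq_bigr => j _; rewrite mulr_sumr.
by apply: eq_bigr => l _; rewrite mxE; ring.
Qed.

(** By the forest formula the quadratic form is a sum of squares with non-negative coefficients, as
    I_1 and the tree weights are non-negative. *)
Lemma diffusion_mx_nonneg_definite (n_gt0 : (0 < n)%N) :
  nonneg_definite (diffusion_mx v mu).
Proof.
rewrite diffusion_mx_forests //; split=> [|x].
  rewrite linearZ /= raddf_sum; congr (_ *: _); apply: eq_bigr => F _.
  by apply/matrixP => j l; rewrite !mxE; congr (_ * _); rewrite mulrC.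
have -> : \sum_(j < d) \sum_(l < d) x 0 j * ((2 / I1 B) *:
    \sum_(F in forests2 mu)
      pair_weight F *: tensor (tree_velocity v F.1) (tree_velocity v F.1)) j l * x 0 l =
  2 / I1 B * \sum_(F in forests2 mu) pair_weight F * dotp x (tree_velocity v F.1) ^+ 2.
  transitivity (2 / I1 B * \sum_(F in forests2 mu) pair_weight F *
      \sum_(j < d) \sum_(l < d)
        x 0 j * tensor (tree_velocity v F.1) (tree_velocity v F.1) j l * x 0 l); last first.
    by congr (_ * _); apply: eq_bigr => F _; rewrite quadratic_tensor.
  under [X in _ = _ * X]eq_bigr do rewrite mulr_sumr.
  rewrite [X in _ = _ * X]exchange_big mulr_sumr; apply: eq_bigr => j _ /=.
  under [X in _ = _ * X]eq_bigr do rewrite mulr_sumr.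
  rewrite [X in _ = _ * X]exchange_big mulr_sumr; apply: eq_bigr => l _ /=.
  rewrite mxE summxE mulrCA -mulrA; congr (_ * _).
  rewrite mulr_sumr mulr_suml; apply: eq_bigr => F _.
  by rewrite !mxE; ring.
apply: mulr_ge0; first by rewrite divr_ge0 // I1_ge0.
apply: sumr_ge0 => F; rewrite inE => /asboolP[[[sub1 _] _] [[sub2 _] _] _ _ _].
have weight_ge0 (T : graph n) : T.2 \subset arcs mu -> 0 <= tree_weight mu T.
  move=> /fintype.subsetP Tsub; apply: prodr_ge0 => a /Tsub.
  by rewrite inE => /andP[_ /ltW].
by rewrite mulr_ge0 ?sqr_ge0 // mulr_ge0 // weight_ge0.
Qed.

End DiffusionMatrix.

Theorem theorem3p11 (R : realType) (n d : nat) (hn : (0 < n)%N) (hd : (0 < d)%N)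
    (v : 'I_n -> 'rV[R]_d) (hv : \sum_(i < n) v i = 0)
    (mu : 'I_n -> 'I_n -> R)
    (mu_sym : forall i j : 'I_n, i != j -> mu i j = mu j i)
    (mu_ge0 : forall i j : 'I_n, i != j -> 0 <= mu i j)
    (hI1 : I1 (transition_mx mu) != 0) :
  [/\ forall lam : 'rV[R]_d -> R, smooth_branch v mu lam ->
        hessian lam 0 = diffusion_mx v mu,
      diffusion_mx v mu =
        (2 / I1 (transition_mx mu)) *:
          \sum_(F in forests2 mu)
            (tree_weight mu F.1 * tree_weight mu F.2) *:
              tensor (tree_velocity v F.1) (tree_velocity v F.1)
    & nonneg_definite (diffusion_mx v mu)].
Proof.
split.
- by move=> lam; apply: smooth_branch_hessian.
- exact: diffusion_mx_forests.
- exact: diffusion_mx_nonneg_definite.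
Qed.
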